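(* Let $r\geq 2$ and let $k_1\geq k_2\geq\cdots\geq k_r\geq t+1$ with $k_1\geq t+2$, and let $n\geq L(k_1,t)$. If $\mathcal{F}_1\subseteq\Pi(n,k_1),\mathcal{F}_2\subseteq\Pi(n,k_2),\ldots,\mathcal{F}_r\subseteq\Pi(n,k_r)$ are $r$-cross $t$-intersecting, then $$\prod_{i=1}^r|\mathcal{F}_i|\leq\prod_{i=1}^r S(n-t,k_i-t).$$ Moreover, equality holds if and only if there is a partition $X$ consisting of $t$ singletons such that $\mathcal{F}_i=\{F\in\Pi(n,k_i):X\subseteq F\}$ for $i=1,\ldots,r$.
   Context: All letters denote positive integers. $[n]=\{1,\ldots,n\}$. A partition is a set of pairwise disjoint nonempty sets, called blocks; $|P|$ is the number of blocks of a partition $P$ and $\cup P$ the union of its blocks. A $k$-partition of a set $M$ is a partition with $k$ blocks whose union is $M$. $\Pi(n,k)$ denotes the set of all $k$-partitions of $[n]$; its size is the Stirling number of the second kind $S(n,k)$, with the convention $S(n,a)=0$ for $a\leq 0$. For partitions $F,G$, $F\cap G$ is the set of blocks common to both. $L(k,t):=(t+1)+(k-t+1)\log_2\big((t+1)(k-t+1)\big)$. Families $\mathcal{F}_i\subseteq\Pi(n,k_i)$, $i\in[r]$, are $r$-cross $t$-intersecting if $|F_1\cap F_2\cap\cdots\cap F_r|\geq t$ for all $F_i\in\mathcal{F}_i$, $i\in[r]$. *)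

(* Defs.v *)
From HB Require Import structures.
From mathcomp Require Import all_boot.
From Stdlib Require Import Reals.
Set Implicit Arguments. Unset Strict Implicit. Unset Printing Implicit Defensive.

Fixpoint stirling2 (n k : nat) : nat :=
  match n, k with
  | 0, 0 => 1
  | 0, _.+1 => 0
  | _.+1, 0 => 0
  | n'.+1, k'.+1 => k'.+1 * stirling2 n' k'.+1 + stirling2 n' k'
  end.

Definition is_partition (n : nat) (P : {set {set 'I_n}}) : bool :=
  trivIset P && (set0 \notin P).

Definition Pi (n k : nat) : {set {set {set 'I_n}}} :=
  [set P : {set {set 'I_n}} | partition P [set: 'I_n] & #|P| == k].

Definition cross_t_intersecting (n r t : nat)
    (F : nat -> {set {set {set 'I_n}}}) : Prop :=
  forall G : nat -> {set {set 'I_n}},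
    (forall i, i < r -> G i \in F i) ->
    t <= #|\bigcap_(i < r) G i|.

Definition log2 (x : R) : R := (ln x / ln 2)%R.
Definition Lbound (k t : nat) : R :=
  (INR t + 1 + (INR k - INR t + 1) * log2 ((INR t + 1) * (INR k - INR t + 1)))%R.

(* Main.v *)
Require Import Defs.
From HB Require Import structures.
From Stdlib Require Import Reals Lra.
From mathcomp Require Import all_boot all_algebra zify.
Set Implicit Arguments. Unset Strict Implicit. Unset Printing Implicit Defensive.
Delimit Scope R_scope with coqR.

(** Any two of the families are cross t-intersecting, and it suffices to show
    that two such families F, G either contain a common t-set X of blocks in all
    their members or satisfy the strict product bound.

    Let a and b be the least sizes of a set of blocks meeting every member of F,
    resp. of G, in at least t blocks.  Branching one block at a time shows that at
    most (l-t+1)^(b-t) S(n-b,k-b) members of F contain a given t-set, hence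
    |F| <= C(a,t) (l-t+1)^(b-t) S(n-b,k-b), and symmetrically for G.  As
    C(a,t) <= (t+1)^(a-t), the product is small as soon as
    S(m,p) > (t+1)(k-t+1) S(m-1,p-1) in the relevant range.  This ratio is
    obtained by counting the splittings of one block of a partition in two, the
    number of splittings being bounded below by AM-GM; it is here that the
    logarithmic threshold on n enters.

    When l = t+1 the last ratio is lost.  If G has two members, the members of F
    all contain the same t blocks of either of them, so a = t.  If G has one
    member Q, then |F| is at most the sum of S(|B|,k-t) over the blocks B of Q,
    and S(-,k-t) is superadditive. *)

(** * Set partitions and Stirling numbers *)

Lemma leq_card_cancel (aT rT : finType) (A : {set aT}) (B : {set rT})
    (f : aT -> rT) (g : rT -> aT) :
  {in A, forall x, f x \in B} -> {in A, cancel f g} -> #|A| <= #|B|.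
Proof.
move=> fAB fK; rewrite -(card_in_imset (can_in_inj fK)).
by apply/subset_leq_card/subsetP => _ /imsetP[x xA ->]; apply: fAB.
Qed.

Lemma card_dep_pairs (I J : finType) (A : {set I}) (B : I -> {set J}) :
  #|[set u : I * J | (u.1 \in A) && (u.2 \in B u.1)]| = \sum_(i in A) #|B i|.
Proof.
rewrite -sum1_card (eq_bigl (fun u => (u.1 \in A) && (u.2 \in B u.1)));
  last by move=> u; rewrite inE.
rewrite -(pair_big_dep (fun i => i \in A) (fun i j => j \in B i) (fun _ _ => 1)) /=.
by apply: eq_bigr => i _; rewrite sum1_card.
Qed.

Section SetPartitions.
Variable T : finType.
Implicit Types (D A B C : {set T}) (P X : {set {set T}}).

Definition kpartitions D (k : nat) : {set {set {set T}}} :=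
  [set P | partition P D & #|P| == k].

Lemma kpartitionsP D k P :
  reflect (partition P D /\ #|P| = k) (P \in kpartitions D k).
Proof. by rewrite inE; apply: (iffP andP) => -[-> /eqP]. Qed.

Lemma partition_neq0 P D B : partition P D -> B \in P -> B != set0.
Proof. by case/and3P=> _ _ P0 BP; apply: contraNneq P0 => <-. Qed.

Lemma partition_notin P D B :
  partition P D -> B != set0 -> [disjoint B & D] -> B \notin P.
Proof.
move=> Ppart B0 dBD; apply/negP => BP; case/set0Pn: B0 => x xB.
by move: (disjointFr dBD xB); rewrite (subsetP (partitionS Ppart BP)).
Qed.

Lemma partition_eq P D A B x :
  partition P D -> A \in P -> B \in P -> x \in A -> x \in B -> A = B.
Proof.
move=> Ppart AP BP xA xB; have tP := partition_trivIset Ppart.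
by rewrite -(def_pblock tP AP xA) (def_pblock tP BP xB).
Qed.

Lemma kpartitionsD1 D k P B :
  P \in kpartitions D k.+1 -> B \in P -> P :\ B \in kpartitions (D :\: B) k.
Proof.
case/kpartitionsP=> pP cP BP; apply/kpartitionsP; split; first exact: partitionD1.
by move: cP; rewrite (cardsD1 B) BP; case.
Qed.

Lemma kpartitionsU1 D k P B :
    P \in kpartitions D k -> B != set0 -> [disjoint B & D] ->
  B |: P \in kpartitions (B :|: D) k.+1.
Proof.
case/kpartitionsP=> pP cP B0 dBD; apply/kpartitionsP.
by rewrite cardsU1 (partition_notin pP) ?cP //; split=> //; apply: partitionU1.
Qed.

Lemma card_kpartitions_singleton D k x : x \in D ->
  #|[set P in kpartitions D k.+1 | [set x] \in P]| = #|kpartitions (D :\ x) k|.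
Proof.
move=> xD; have x0 : [set x] != set0 by apply/set0Pn; exists x; rewrite inE.
have dx : [disjoint [set x] & D :\ x] by rewrite disjoints1 !inE eqxx.
apply/eqP; rewrite eqn_leq; apply/andP; split.
  apply: (@leq_card_cancel _ _ _ _ (fun P => P :\ [set x]) (fun P => [set x] |: P)).
    by move=> P; rewrite inE => /andP[PD xP]; apply: kpartitionsD1.
  by move=> P; rewrite inE => /andP[_ xP]; rewrite setD1K.
apply: (@leq_card_cancel _ _ _ _ (fun P => [set x] |: P) (fun P => P :\ [set x])).
  by move=> P PD; rewrite inE setU11 andbT -(setD1K xD) kpartitionsU1.
move=> P /kpartitionsP[PD _] /=; rewrite setU1K //; exact: partition_notin PD _ _.
Qed.

Lemma kpartitions_replace D E k P B C :
    P \in kpartitions D k -> B \in P -> C != set0 ->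
    [disjoint C & D :\: B] -> C :|: (D :\: B) = E ->
  C |: (P :\ B) \in kpartitions E k.
Proof.
move=> PD BP C0 dC <-; case: k PD => [|k] PD.
  by case/kpartitionsP: PD => _ /cards0_eq P0; rewrite P0 inE in BP.
by apply: kpartitionsU1 => //; apply: kpartitionsD1.
Qed.

(** Deleting [x] from its block and marking what is left of that block is a bijection onto
    partitions of [D :\ x] with one marked block; each of these has [k.+1] possible marks. The rest
    of the block is nonempty because [[set x]] is not a block. *)
Lemma card_kpartitions_nonsingleton D k x : x \in D ->
  #|[set P in kpartitions D k.+1 | [set x] \notin P]|
    = k.+1 * #|kpartitions (D :\ x) k.+1|.
Proof.
move=> xD; set U := [set _ in _ | _].
pose V := [set u : {set {set T}} * {set T} |
             (u.1 \in kpartitions (D :\ x) k.+1) && (u.2 \in u.1)].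
have -> : k.+1 * #|kpartitions (D :\ x) k.+1| = #|V|.
  rewrite (card_dep_pairs (kpartitions (D :\ x) k.+1) id) (eq_bigr (fun=> k.+1)).
    by rewrite sum_nat_const mulnC.
  by move=> P /kpartitionsP[].
apply/eqP; rewrite eqn_leq; apply/andP; split.
  apply: (@leq_card_cancel _ _ _ _
    (fun P => let C := pblock P x in ((C :\ x) |: (P :\ C), C :\ x))
    (fun u => (x |: u.2) |: (u.1 :\ u.2))) => P; rewrite inE => /andP[PD xP];
  have [pP cP] := kpartitionsP _ _ _ PD; have xc : x \in cover P
    by rewrite (cover_partition pP).
    rewrite inE /= setU11 andbT.
    have CP := pblock_mem xc; have xC := xc; rewrite -mem_pblock in xC.
    apply: (kpartitions_replace PD CP).
    - apply: contraNneq xP => C0; suff -> : [set x] = pblock P x by [].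
      by rewrite -(setD1K xC) C0 setU0.
    - rewrite disjoints_subset; apply/subsetP => y; rewrite !inE => /andP[_ ->].
      by [].
    - apply/setP=> y; rewrite !inE.
      case: (y =P x) => [->|_] /=; first by rewrite xC.
      case yC: (y \in pblock P x) => //=.
      by rewrite (subsetP (partitionS pP CP)).
  have CP := pblock_mem xc; have xC := xc; rewrite -mem_pblock in xC.
  rewrite /= setD1K // setU1K ?setD1K //.
  have pQ := partitionD1 pP CP; apply: (partition_notin pQ).
    apply: contraNneq xP => C0; suff -> : [set x] = pblock P x by [].
    by rewrite -(setD1K xC) C0 setU0.
  by rewrite disjoints_subset; apply/subsetP => y; rewrite !inE => /andP[_ ->].
apply: (@leq_card_cancel _ _ _ _
    (fun u => (x |: u.2) |: (u.1 :\ u.2))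
    (fun P => let C := pblock P x in ((C :\ x) |: (P :\ C), C :\ x)));
  move=> [P C] /=; rewrite inE /= => /andP[PD CP]; have [pP cP] := kpartitionsP _ _ _ PD;
  have sCD := partitionS pP CP; have C0 := partition_neq0 pP CP;
  have xC : x \notin C by (apply/negP => /(subsetP sCD); rewrite !inE eqxx).
  have dx : [disjoint x |: C & (D :\ x) :\: C].
    by rewrite disjoints_subset; apply/subsetP=> y; rewrite !inE; case: (y == x) => /= [_|->]; rewrite ?andbF.
  have eD : (x |: C) :|: ((D :\ x) :\: C) = D.
    apply/setP=> y; rewrite !inE; case: (y =P x) => [->|yx] /=; first by rewrite xD.
    by case yC: (y \in C) => //=; rewrite (subsetP (subset_trans sCD (subD1set _ _))).
  have xC0 : x |: C != set0 by apply/set0Pn; exists x; rewrite setU11.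
  rewrite inE (kpartitions_replace PD CP xC0 dx eD) /= !inE negb_or.
  apply/andP; split.
    case/set0Pn: C0 => y yC; apply/eqP => /setP/(_ y); rewrite !inE yC orbT.
    by move/eqP => yx; rewrite -yx yC in xC.
  apply/negP => /andP[_ xP]; move: (subsetP (partitionS pP xP) x).
  by rewrite !inE eqxx => /(_ isT).
have dx : [disjoint x |: C & (D :\ x) :\: C].
  by rewrite disjoints_subset; apply/subsetP=> y; rewrite !inE; case: (y == x) => /= [_|->]; rewrite ?andbF.
have xC0 : x |: C != set0 by apply/set0Pn; exists x; rewrite setU11.
have pQ := partitionU1 (partitionD1 pP CP) xC0 dx.
have -> : pblock ((x |: C) |: (P :\ C)) x = x |: C.
  by apply: (def_pblock (partition_trivIset pQ)); rewrite setU11.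
by rewrite !setU1K ?setD1K //; exact: partition_notin (partitionD1 pP CP) xC0 dx.
Qed.

Lemma kpartitions_set0 k : kpartitions set0 k = if k is 0 then [set set0] else set0.
Proof.
apply/setP=> P; rewrite inE; apply/andP/idP => [[pP /eqP cP]|].
  have P0 : P = set0.
    apply/eqP; apply: contraT => /set0Pn[B BP].
    by move: (partition_neq0 pP BP) (partitionS pP BP); rewrite subset0 => /negPf->.
  by move: cP; rewrite P0 cards0 => <-; rewrite inE.
case: k => [|k]; rewrite inE // => /eqP->; split; last by rewrite cards0.
by apply/and3P; split; rewrite ?inE // /cover ?big_set0 //; apply/trivIsetP=> A B; rewrite inE.
Qed.

(** The two summands of the recurrence correspond to a fixed [x] forming a block alone or not. *)
Lemma card_kpartitions D k : #|kpartitions D k| = stirling2 #|D| k.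
Proof.
move eq_m: #|D| => m; elim: m D eq_m k => [|m IH] D cD k.
  by rewrite (cards0_eq cD) kpartitions_set0; case: k => [|k]; rewrite ?cards1 ?cards0.
have /card_gt0P[x xD] : 0 < #|D| by rewrite cD.
have cDx : #|D :\ x| = m by move: cD; rewrite (cardsD1 x) xD; case.
case: k => [|k] /=.
  apply/eqP; rewrite cards_eq0; apply/eqP/setP => P; rewrite in_set0; apply/negP => /kpartitionsP[pP /cards0_eq P0].
  by move: (cover_partition pP); rewrite P0 /cover big_set0 => E; rewrite -E inE in xD.
rewrite -(IH _ cDx) -(IH _ cDx) -card_kpartitions_nonsingleton //.
rewrite -card_kpartitions_singleton // addnC.
rewrite -(cardsID [set P : {set {set T}} | [set x] \in P] (kpartitions D k.+1)).
by congr (_ + _); apply: eq_card => Q; rewrite !inE // andbC.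
Qed.

Definition star (D : {set T}) (k : nat) (X : {set {set T}}) : {set {set {set T}}} :=
  [set P in kpartitions D k | X \subset P].

Lemma partition_sub P D X : partition P D -> X \subset P -> partition X (cover X).
Proof.
case/and3P=> _ tP P0 sXP; apply/and3P; split; rewrite ?(trivIsetS sXP) //.
by apply: contra P0; apply: (subsetP sXP).
Qed.

Lemma partitionD P D X :
  partition P D -> X \subset P -> partition (P :\: X) (D :\: cover X).
Proof.
move=> pP sXP; have [/eqP cP tP P0] := and3P pP.
have sDP : P :\: X \subset P by apply: subsetDl.
rewrite /partition (trivIsetS sDP) //= andbC; apply/andP; split.
  by apply: contra P0; apply: (subsetP sDP).
apply/eqP/setP=> y; rewrite inE; apply/bigcupP/andP => [[B]|[yX yD]].
  rewrite inE => /andP[BX BP] yB; split; last by rewrite (subsetP (partitionS pP BP)).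
  apply: contra BX => /bigcupP[A AX yA].
  by rewrite (partition_eq pP BP (subsetP sXP _ AX) yB yA).
rewrite -cP in yD; exists (pblock P y); last by rewrite mem_pblock.
rewrite inE pblock_mem // andbT; apply: contra yX => ?.
by apply/bigcupP; exists (pblock P y); rewrite ?mem_pblock.
Qed.

Lemma partitionU P X D E :
  partition P D -> partition X E -> [disjoint D & E] -> partition (P :|: X) (D :|: E).
Proof.
case/and3P=> /eqP <- tP P0 /and3P[/eqP <- tX X0] dis.
by apply/and3P; rewrite trivIsetU // inE negb_or P0 X0; split=> //; rewrite /cover bigcup_setU.
Qed.

Lemma leq_card_partition X D : partition X D -> #|X| <= #|D|.
Proof.
move=> pX; rewrite (card_partition pX) -sum1_card; apply: leq_sum => B BX.
by rewrite card_gt0 (partition_neq0 pX).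
Qed.

(** Removing the blocks of [X] is a bijection onto partitions of the points that [X] leaves
    uncovered. The bound on [#|X|] guards the truncated subtraction [k - #|X|]: an overlong [X]
    covering [D] would give [stirling2 0 0 = 1] for an empty star. *)
Lemma card_star D k X :
    partition X (cover X) -> cover X \subset D -> #|X| <= k ->
  #|star D k X| = stirling2 (#|D| - #|cover X|) (k - #|X|).
Proof.
move=> pX sXD leXk; rewrite -cardsDS // -card_kpartitions.
have dX : [disjoint D :\: cover X & cover X].
  by rewrite disjoints_subset; apply/subsetP=> y; rewrite !inE => /andP[].
apply/eqP; rewrite eqn_leq; apply/andP; split.
  apply: (@leq_card_cancel _ _ _ _ (fun P => P :\: X) (fun P => P :|: X)) => P.
    rewrite inE => /andP[/kpartitionsP[pP cP] sXP]; apply/kpartitionsP.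
    by rewrite cardsDS // cP; split=> //; apply: partitionD.
  rewrite inE => /andP[_ sXP]; apply/setP=> B; rewrite !inE.
  by case BX: (B \in X); rewrite ?orbF // orbT (subsetP sXP).
have dPX P : partition P (D :\: cover X) -> P :&: X = set0.
  move=> pP; apply/setP=> B; rewrite !inE; apply/negP=> /andP[BP BX].
  have B0 := partition_neq0 pX BX.
  apply/negP: BP; apply: (partition_notin pP B0); rewrite disjoint_sym.
  by apply: (disjointWr _ dX); apply: (bigcup_sup B).
apply: (@leq_card_cancel _ _ _ _ (fun P => P :|: X) (fun P => P :\: X)) => P /kpartitionsP[pP cP].
  rewrite inE subsetUr andbT; apply/kpartitionsP; split.
    by have := partitionU pP pX dX; rewrite [_ :\: _ :|: _]setUC -{1}(setIidPr sXD) setID.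
  by rewrite cardsU dPX // cards0 subn0 cP subnK.
rewrite /=; apply/setP=> B; move/setP/(_ B): (dPX P pP); rewrite !inE.
by case: (B \in X); case: (B \in P).
Qed.

Lemma leq_card_union (I : finType) (A : {set I}) (F : {set T}) (H : I -> {set T}) :
    (forall x, x \in F -> exists2 i, i \in A & x \in H i) ->
  #|F| <= \sum_(i in A) #|H i|.
Proof.
move=> FH; have -> : \sum_(i in A) #|H i| = \sum_(x : T) \sum_(i in A) (x \in H i).
  rewrite exchange_big /=; apply: eq_bigr => i _.
  by rewrite -sum1_card big_mkcond /=; apply: eq_bigr => x _; case: ifP.
rewrite -sum1_card big_mkcond; apply: leq_sum => x _; case: ifP => // xF.
by have [i iA xH] := FH x xF; rewrite (bigD1 i) //= xH.
Qed.

End SetPartitions.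

Lemma stirling2_small n k : n < k -> stirling2 n k = 0.
Proof.
elim: n k => [|n IH] [|k] //= nk; rewrite !IH ?muln0 //; exact: ltnW.
Qed.

Lemma stirling2_gt0 n k : 0 < k -> k <= n -> 0 < stirling2 n k.
Proof.
elim: n k => [|n IH] [|k] //= _; rewrite ltnS => kn.
case: k kn => [|k] kn; last by rewrite addn_gt0 (IH k.+1) ?orbT.
by case: n IH {kn} => [|n] IH //; rewrite addn_gt0 muln_gt0 (IH 1).
Qed.

Lemma stirling2_1 n : 0 < n -> stirling2 n 1 = 1.
Proof. by elim: n => [//|[|n] IH] _ //; move: (IH isT) => /= ->. Qed.

Lemma leq_stirling2 m n k : 0 < k -> m <= n -> stirling2 m k <= stirling2 n k.
Proof.
move=> k0 /subnK <-; elim: (n - m) => [//|d IH]; apply: leq_trans IH _.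
by case: k k0 => // k _; rewrite addSn /= mulSn -addnA leq_addr.
Qed.

Lemma ltn_stirling2 m n k :
  1 < k -> k <= n -> m < n -> stirling2 m k < stirling2 n k.
Proof.
move=> k1 kn mn; case: n kn mn => // n kn; rewrite ltnS => mn.
apply: leq_ltn_trans (leq_stirling2 (ltnW k1) mn) _.
case: k k1 kn => [//|k] k1 kn /=; rewrite mulSn -addnA -addn1 leq_add2l.
by rewrite addn_gt0 stirling2_gt0 // orbT.
Qed.

Lemma double_stirling2 m k : 1 < k -> 2 * stirling2 m k <= stirling2 m.+1 k.
Proof.
by case: k => // k k1 /=; rewrite (leq_trans _ (leq_addr _ _)) // leq_mul2r k1 orbT.
Qed.

Lemma double_stirling2_lt m k :
  1 < k -> 0 < stirling2 m k -> 2 * stirling2 m k < stirling2 m.+1 k.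
Proof.
move=> k1 Smk; have km : k <= m by rewrite leqNgt; apply: contraL Smk => /stirling2_small ->.
case: k k1 Smk km => // k k1 _ km /=.
rewrite -[X in X < _]addn0 -addnS leq_add ?leq_mul2r ?k1 ?orbT //.
by rewrite stirling2_gt0 // ltnW.
Qed.

(** * Growth of Stirling numbers *)

(* Split one block of a [p]-partition in two: the resulting [p.+1]-partition with
   the ordered pair of new blocks determines the original partition and the split. *)
Lemma sum_block_splits (T : finType) (D : {set T}) (p : nat) :
  \sum_(P in kpartitions D p) \sum_(A in P) (2 ^ #|A| - 2)
    <= p.+1 * p * #|kpartitions D p.+1|.
Proof.
pose inner (A : {set T}) := (powerset A :\ set0) :\ A.
pose splits (P : {set {set T}}) := [set v : {set T} * {set T} | (v.1 \in P) && (v.2 \in inner v.1)].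
pose merges (P : {set {set T}}) := [set v : {set T} * {set T} | (v.1 \in P) && (v.2 \in P :\ v.1)].
have -> : p.+1 * p * #|kpartitions D p.+1| =
    \sum_(P in kpartitions D p.+1) #|merges P|.
  rewrite (eq_bigr (fun=> p.+1 * p)); first by rewrite sum_nat_const mulnC.
  move=> P /kpartitionsP[_ cP].
  rewrite (card_dep_pairs P (fun B => P :\ B)) (eq_bigr (fun=> p)) ?sum_nat_const ?cP // => B BP.
  by move: cP; rewrite (cardsD1 B) BP; case.
apply: (@leq_trans (\sum_(P in kpartitions D p) #|splits P|)).
  apply: leq_sum => P PD; rewrite (card_dep_pairs P inner); apply: leq_sum => A AP.
  have [pP _] := kpartitionsP _ _ _ PD; have A0 := partition_neq0 pP AP.
  have := cardsD1 A (powerset A :\ set0); have := cardsD1 set0 (powerset A).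
  by rewrite /inner card_powerset !inE A0 sub0set subxx /= => -> ->; rewrite !add1n subn2.
have facts (P : {set {set T}}) (A B : {set T}) : P \in kpartitions D p -> A \in P -> B \in inner A ->
    [/\ [/\ B != set0, B \subset A & A \subset D], A :\: B != set0,
     [disjoint A :\: B & D :\: A], [disjoint B & (A :\: B) :|: (D :\: A)] &
     (A :\: B) |: (P :\ A) \in kpartitions ((A :\: B) :|: (D :\: A)) p].
  move=> PD AP /setD1P[BA /setD1P[B0]]; rewrite powersetE => sBA.
  have [pP cP] := kpartitionsP _ _ _ PD; have sAD := partitionS pP AP.
  have C0 : A :\: B != set0.
    by rewrite setD_eq0; apply: contra BA => sAB; rewrite eqEsubset sBA.
  have dC : [disjoint A :\: B & D :\: A].
    by rewrite disjoints_subset; apply/subsetP => y; rewrite !inE => /andP[_ ->].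
  have PE := kpartitions_replace PD AP C0 dC erefl.
  split=> //.
  rewrite disjoints_subset; apply/subsetP => y yB.
  by rewrite !inE yB (subsetP sBA).
rewrite -(card_dep_pairs _ splits) -(card_dep_pairs _ merges).
apply: (@leq_card_cancel _ _ _ _
  (fun u => (u.2.2 |: ((u.2.1 :\: u.2.2) |: (u.1 :\ u.2.1)), (u.2.2, u.2.1 :\: u.2.2)))
  (fun u => ((u.2.1 :|: u.2.2) |: ((u.1 :\ u.2.1) :\ u.2.2), (u.2.1 :|: u.2.2, u.2.1))));
  move=> [P [A B]]; rewrite inE /= => /andP[PD]; rewrite inE /= => /andP[AP /(facts P A B PD AP)];
  case=> -[B0 sBA sAD] C0 dC dB PE.
  have eD : B :|: ((A :\: B) :|: (D :\: A)) = D.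
    apply/setP=> y; rewrite !inE; case yB: (y \in B).
      by rewrite (subsetP sAD) // (subsetP sBA).
    by case yA: (y \in A) => //=; rewrite (subsetP sAD).
  have := kpartitionsU1 PE B0 dB; rewrite eD => PD'.
  rewrite inE /= PD' inE /= setU11 in_setD1 !in_setU1 eqxx orbT andbT.
  by case/set0Pn: B0 => y yB; apply/eqP => /setP/(_ y); rewrite !inE yB.
have eA : B :|: (A :\: B) = A by rewrite -{1}(setIidPr sBA) setID.
rewrite eA setU1K; last by have [pE _] := kpartitionsP _ _ _ PE; apply: partition_notin pE B0 dB.
have [pP _] := kpartitionsP _ _ _ PD.
by rewrite setU1K ?setD1K // (partition_notin (partitionD1 pP AP)).
Qed.

(** The numbers [2 ^ #|A|] multiply to [2 ^ #|D|], so their geometric mean is at least [c], and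
    AM-GM bounds their sum. Comparing [p]-th powers avoids roots. *)
Lemma leq_sum_exp2 (T : finType) (D : {set T}) (P : {set {set T}}) (p c : nat) :
    P \in kpartitions D p -> 0 < p -> c ^ p <= 2 ^ #|D| ->
  p * c <= \sum_(A in P) 2 ^ #|A|.
Proof.
move=> /kpartitionsP[pP cP] p0 cD; rewrite -(@leq_exp2r _ _ p) //.
apply: (@leq_trans (\prod_(A in P) (2 ^ #|A| * p))).
  rewrite big_split /= -expn_sum -(card_partition pP) prod_nat_const cP expnMn.
  by rewrite mulnC leq_mul2r cD orbT.
rewrite -(Num.Theory.ler_nat int) GRing.natr_prod GRing.natrX GRing.natr_sum -cP.
under eq_bigr do rewrite GRing.natrM GRing.mulr_natr.
by apply: (Num.Theory.leif_AGM_scaled _).1 => A _; rewrite Num.Theory.mulrn_wge0 ?Num.Theory.ler0n.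
Qed.

(** By AM-GM a [p]-partition has at least [p * (c - 2)] splittings, so the splitting count gives
    (c-2) S(m,p) <= (p+1) S(m,p+1) after division by [p]. The recurrence adds one more S(m,p),
    turning c-2 into c-1. *)
Lemma stirling2_ratio m p c :
  0 < p -> c ^ p <= 2 ^ m -> (c - 1) * stirling2 m p <= stirling2 m.+1 p.+1.
Proof.
move=> p0 cm; have := sum_block_splits [set: 'I_m] p.
rewrite !card_kpartitions cardsT card_ord => split_le.
have: stirling2 m p * (p * c - 2 * p) <= p.+1 * p * stirling2 m p.+1.
  apply: leq_trans split_le; rewrite -{1}(card_ord m) -cardsT -card_kpartitions.
  rewrite -sum_nat_const; apply: leq_sum => P PD; rewrite leq_subLR.
  apply: (@leq_trans (\sum_(A in P) 2 ^ #|A|)).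
    by apply: (leq_sum_exp2 PD) => //; rewrite cardsT card_ord.
  have [_ cP] := kpartitionsP _ _ _ PD.
  rewrite -{1}cP mulnC -sum_nat_const -big_split /=; apply: leq_sum => A _.
  by rewrite -leq_subLR.
rewrite [2 * p]mulnC -mulnBr mulnCA -[p.+1 * p]mulnC -mulnA leq_pmul2l // => H.
case: c cm H => [|[|c]] // cm H; rewrite subn1 /=.
by rewrite mulSn [stirling2 _ _.+1]/= addnC leq_add2r; move: H; rewrite subn2 /= mulnC.
Qed.

(** This is Bernoulli's inequality (1 - 2/(Q+2))^e >= 1 - 2e/(Q+2) with denominators cleared. *)
Lemma bernoulli_nat Q e : 2 * e <= Q + 2 ->
  (Q + 2) ^ e * (Q + 2 - 2 * e) <= Q ^ e * (Q + 2).
Proof.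
elim: e => [|e IH] le_eQ; first by rewrite !expn0; lia.
have {}IH := IH ltac:(lia); rewrite !expnS.
apply: (@leq_trans (Q * ((Q + 2) ^ e * (Q + 2 - 2 * e)))); last by rewrite -mulnA leq_mul2l IH orbT.
rewrite [_ * (Q + 2) ^ e]mulnC -mulnA [Q * (_ * _)]mulnCA leq_mul2l; apply/orP; right.
have [d dE] : exists d, Q = 2 * e + d by exists (Q - 2 * e); lia.
by subst Q; nia.
Qed.

(** Bernoulli is too weak for the whole exponent but gives (1+2/Q)^d <= (Q+2)/2 when 2d <= Q.
    Applied to the two halves of [e], it yields (1+2/Q)^e <= (Q+2)^2/4 <= Q^2. Two spare exponents
    thus pay for replacing [Q] by [Q + 2]. *)
Lemma leq_expn_add2 Q e : 2 < Q -> e.+2 <= Q -> (Q + 2) ^ e <= Q ^ e.+2.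
Proof.
move=> Q2 eQ.
have half d : 2 * d <= Q -> 2 * (Q + 2) ^ d <= Q ^ d * (Q + 2).
  move=> dQ; apply: leq_trans (bernoulli_nat _); last lia.
  by rewrite mulnC leq_mul2l; apply/orP; right; lia.
have eE : e = e./2 + uphalf e by rewrite addnC uphalf_half -addnA addnn odd_double_half.
have h1 := half e./2 ltac:(lia); have h2 := half (uphalf e) ltac:(lia).
have := leq_mul h1 h2.
move=> h; have : 4 * (Q + 2) ^ e <= Q ^ e * (Q + 2) ^ 2.
  by rewrite [in (Q + 2) ^ e]eE [in Q ^ e]eE !expnD expnS expn1; lia.
have : (Q + 2) ^ 2 <= 4 * Q ^ 2 by rewrite !expnS !expn0; nia.
rewrite -(@leq_pmul2l (Q ^ e)) ?expn_gt0 1?(ltn_trans _ Q2) //.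
rewrite mulnCA -expnD [e + 2]addn2 => le2 le1.
by rewrite -(@leq_pmul2l 4) //; apply: leq_trans le1 le2.
Qed.

(* The value [1] for [x >= k] is needed: a full [k]-partition is its own star,
   whereas [stirling2 (n - k) 0 = 0]. *)
Definition star_bound (n k x : nat) : nat :=
  if x < k then stirling2 (n - x) (k - x) else 1.

(** * Decay of star bounds above the threshold *)

Section Growth.
(** In the application [N] is n-t, [i] is k-t, [j] is an upper bound for the values k-t, and [Q] is
    (t+1)(j+1). Then [QN] is the threshold on n freed of logarithms. *)
Variables N i j Q : nat.
Hypotheses (i2 : 1 < i) (ij : i <= j) (jQ : j < Q) (QN : Q ^ j.+1 <= 2 ^ N.-1).

Lemma growth_size : j.+1 < N.
Proof.
have: 2 ^ j.+1 <= 2 ^ N.-1 by apply: leq_trans QN; rewrite leq_exp2r //; lia.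
by rewrite leq_exp2l //; lia.
Qed.

(** [stirling2_ratio] with c = Q+2 yields a ratio of Q+1, strictly above [Q]. Its hypothesis follows
    from the chain (Q+2)^(i-d-1) 2^d <= (Q+2)^(j-1) <= Q^(j+1) <= 2^(N-1). *)
Lemma stirling2_step d : d.+1 < i ->
  Q.+1 * stirling2 (N - d.+1) (i - d.+1) <= stirling2 (N - d) (i - d).
Proof.
move=> di; have jN := growth_size.
have -> : N - d = (N - d.+1).+1 by lia.
have -> : i - d = (i - d.+1).+1 by lia.
have -> : Q.+1 = Q + 2 - 1 by lia.
apply: stirling2_ratio; first lia.
rewrite -(@leq_pmul2r (2 ^ d)) ?expn_gt0 //.
have -> : 2 ^ (N - d.+1) * 2 ^ d = 2 ^ N.-1 by rewrite -expnD; congr (2 ^ _); lia.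
apply: leq_trans QN; apply: (@leq_trans ((Q + 2) ^ j.-1)).
  apply: (@leq_trans ((Q + 2) ^ (i - d.+1) * (Q + 2) ^ d)).
    by rewrite leq_mul2l; apply/orP; right; case: d di => // d _; rewrite leq_exp2r //; lia.
  by rewrite -expnD leq_pexp2l; lia.
have -> : j.+1 = j.-1.+2 by lia.
by apply: leq_expn_add2; lia.
Qed.

(** Here the ratio is taken at one block, with c = Q^2+2, so that a single step gains more than
    [Q ^ 2]. This supplies the last two factors when the fixed blocks exhaust the partition. *)
Lemma stirling2_two : Q ^ 2 < stirling2 (N - (i - 2)) 2.
Proof.
have jN := growth_size.
have -> : N - (i - 2) = (N - i.-1).+1 by lia.
have := @stirling2_ratio (N - i.-1) 1 (Q ^ 2 + 2) isT.
rewrite stirling2_1; last lia.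
rewrite muln1 expn1 => H; apply: leq_trans (H _); first lia.
rewrite -(@leq_pmul2r (2 ^ (i - 2))) ?expn_gt0 //.
have -> : 2 ^ (N - i.-1) * 2 ^ (i - 2) = 2 ^ N.-1 by rewrite -expnD; congr (2 ^ _); lia.
apply: leq_trans QN; have -> : j.+1 = 3 + (j - 2) by lia.
rewrite expnD; apply: leq_mul; first by rewrite !expnS expn0; nia.
apply: (@leq_trans (Q ^ (i - 2))); last by rewrite leq_pexp2l; lia.
by case: (i - 2) => // d; rewrite leq_exp2r //; lia.
Qed.

Lemma stirling2_growth d : d < i -> Q ^ d * stirling2 (N - d) (i - d) <= stirling2 N i.
Proof.
elim: d => [|d IH] di; first by rewrite !subn0 mul1n.
apply: leq_trans (IH (ltnW di)); rewrite expnSr -mulnA leq_mul2l.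
by rewrite (leq_trans _ (stirling2_step di)) ?orbT // leq_mul2r leqnSn orbT.
Qed.

(** For [d < i] the factors telescope, and the last one is strict since it is Q+1. For [d = i] the
    star bound is 1 while telescoping down to one block gives only i-1 factors; the chain therefore
    stops at two blocks and [stirling2_two] finishes. *)
Lemma star_bound_growth d : 0 < d -> d <= i -> Q ^ d * star_bound N i d < stirling2 N i.
Proof.
have jN := growth_size; have Q0 : 0 < Q by lia.
case: d => // d _; rewrite leq_eqVlt => /predU1P[di|di].
  have -> : star_bound N i d.+1 = 1 by rewrite /star_bound di ltnn.
  apply: leq_trans (stirling2_growth (_ : i - 2 < i)); last lia.
  have -> : i - (i - 2) = 2 by lia.
  have -> : d.+1 = (i - 2) + 2 by lia.
  by rewrite muln1 expnD ltn_pmul2l ?expn_gt0 ?Q0 // stirling2_two.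
apply: leq_trans (stirling2_growth (ltnW di)).
rewrite /star_bound di expnSr -mulnA ltn_pmul2l ?expn_gt0 ?Q0 //.
apply: leq_trans (stirling2_step di); rewrite ltn_pmul2r //.
by apply: stirling2_gt0; lia.
Qed.

End Growth.

(** * Two cross-intersecting families *)

Lemma exists_subset_card (I : finType) (A : {set I}) m :
  m <= #|A| -> exists2 W : {set I}, W \subset A & #|W| = m.
Proof.
move=> mA; have: 0 < #|[set W : {set I} | W \subset A & #|W| == m]|.
  by rewrite cards_draws bin_gt0.
by case/card_gt0P=> W; rewrite inE => /andP[sW /eqP cW]; exists W.
Qed.

(** Raising [d] by one multiplies the binomial by (t+d+1)/(d+1), which is at most t+1. *)
Lemma leq_bin_exp t d : 'C(t + d, t) <= t.+1 ^ d.
Proof.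
elim: d => [|d IH]; first by rewrite addn0 binn.
have := mul_bin_diag (t + d.+1) d.
have -> : 'C(t + d.+1, d.+1) = 'C(t + d.+1, t) by rewrite -bin_sub ?leq_addl // addnK.
have -> : 'C((t + d.+1).-1, d) = 'C(t + d, t).
  by rewrite addnS -bin_sub ?leq_addl // addnK.
move=> E; rewrite -(@leq_pmul2l d.+1) // -E expnS mulnA; apply: leq_mul => //; lia.
Qed.

(** For 1 <= u <= v the left side is at most 2 S(v+1,j) <= S(v+2,j), and v+2 <= u+v+1. The shift by
    one matches the count of points by block sizes minus one in [cross_dichotomy_single]. *)
Lemma stirling2_superadditive j u v : 1 < j ->
  stirling2 u.+1 j + stirling2 v.+1 j <= stirling2 (u + v).+1 j.
Proof.
move=> j1; wlog uv : u v / u <= v.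
  by move=> H; case/orP: (leq_total u v) => /H //; rewrite addnC [v + u]addnC.
case: u uv => [|u] uv; first by rewrite (stirling2_small j1).
apply: (@leq_trans (2 * stirling2 v.+1 j)).
  by rewrite mul2n -addnn leq_add2r leq_stirling2 // ltnW.
apply: leq_trans (double_stirling2 _ j1) _.
by apply: leq_stirling2; [exact: ltnW | rewrite ltnS addSn ltnS leq_addl].
Qed.

Lemma stirling2_superadditive_lt j u v : 1 < j ->
    0 < stirling2 u.+1 j -> 0 < stirling2 v.+1 j ->
  stirling2 u.+1 j + stirling2 v.+1 j < stirling2 (u + v).+1 j.
Proof.
move=> j1; wlog uv : u v / u <= v.
  by move=> H; case/orP: (leq_total u v) => /H // + Su Sv => /(_ Sv Su); rewrite addnC [v + u]addnC.
case: u uv => [|u] uv Su Sv; first by rewrite (stirling2_small j1) in Su.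
apply: (@leq_ltn_trans (2 * stirling2 v.+1 j)).
  by rewrite mul2n -addnn leq_add2r leq_stirling2 // ltnW.
apply: leq_trans (double_stirling2_lt j1 Sv) _.
by apply: leq_stirling2; [exact: ltnW | rewrite ltnS addSn ltnS leq_addl].
Qed.

Lemma sum_stirling2 (I : finType) (A : {set I}) (f : I -> nat) j : 1 < j ->
  \sum_(i in A) stirling2 (f i).+1 j <= stirling2 (\sum_(i in A) f i).+1 j.
Proof.
move=> j1; apply: (big_rec2 (fun x y => x <= stirling2 y.+1 j)) => // i x y _ le.
by apply: leq_trans (stirling2_superadditive _ _ j1); rewrite leq_add2l.
Qed.

Lemma sum_stirling2_lt (I : finType) (A : {set I}) (f : I -> nat) j a b :
    1 < j -> a \in A -> b \in A -> a != b ->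
    0 < stirling2 (f a).+1 j -> 0 < stirling2 (f b).+1 j ->
  \sum_(i in A) stirling2 (f i).+1 j < stirling2 (\sum_(i in A) f i).+1 j.
Proof.
move=> j1 aA bA ab Sa Sb.
have bA' : b \in A :\ a by rewrite !inE eq_sym ab.
rewrite !(big_setD1 a aA) !(big_setD1 b bA') /= !addnA.
apply: (@leq_trans (stirling2 (f a + f b).+1 j + stirling2 (\sum_(i in A :\ a :\ b) f i).+1 j)).
  by rewrite -addSn leq_add // ?stirling2_superadditive_lt // sum_stirling2.
exact: stirling2_superadditive.
Qed.

Section CrossIntersecting.
Variable T : finType.
Local Notation kparts := (kpartitions [set: T]).
Implicit Types (F G : {set {set {set T}}}) (P Q X Y : {set {set T}}) (B C : {set T}).

Definition t_cover t Y F := [forall P in F, t <= #|Y :&: P|].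

Definition cross t F G := forall P Q, P \in F -> Q \in G -> t <= #|P :&: Q|.

Definition link F X := [set P in F | X \subset P].

Lemma cross_sym t F G : cross t F G -> cross t G F.
Proof. by move=> FG P Q PG QF; rewrite setIC FG. Qed.

(** A nonempty star makes [X] a set of disjoint nonempty blocks covering at least [#|X|] points, and
    Stirling numbers grow with the number of points. If [#|X| = k], the only possible member is [X]
    itself. *)
Lemma card_star_le k X : #|star [set: T] k X| <= star_bound #|T| k #|X|.
Proof.
have [->|/set0Pn[P]] := eqVneq (star [set: T] k X) set0; first by rewrite cards0.
rewrite inE => /andP[/kpartitionsP[pP cP] sXP].
have pX := partition_sub pP sXP; have leX : #|X| <= k by rewrite -cP subset_leq_card.
rewrite /star_bound; case: ltnP => [ltX|geX].
  rewrite card_star // cardsT leq_stirling2 ?subn_gt0 // leq_sub2l //.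
  exact: leq_card_partition.
suff /subset_leq_card : star [set: T] k X \subset [set X] by rewrite cards1.
apply/subsetP=> Q; rewrite !inE => /andP[/andP[_ /eqP cQ] sXQ].
by rewrite eq_sym eqEcard sXQ cQ.
Qed.

Lemma link_star F k X : F \subset kparts k -> link F X \subset star [set: T] k X.
Proof.
move=> sF; apply/subsetP=> P; rewrite !inE => /andP[PF ->]; rewrite andbT.
by have := subsetP sF P PF; rewrite inE.
Qed.

Lemma partition_sub_eq P Q D :
  partition P D -> partition Q D -> Q \subset P -> P = Q.
Proof.
move=> pP pQ sQP; have := partitionD pP sQP; rewrite (cover_partition pQ) setDv => p0.
apply/eqP; rewrite eqEsubset sQP andbT -setD_eq0; apply: contraT => /set0Pn[B BPQ].
by move: (partition_neq0 p0 BPQ) (partitionS p0 BPQ); rewrite subset0 => /negPf->.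
Qed.

(* Any [l - t + 1] blocks of [Q] must meet a [P] sharing at least [t] blocks with [Q]. *)
Lemma link_step F G l t c X Q :
    G \subset kparts l -> cross t F G -> t <= l -> Q \in G -> #|X :&: Q| < t ->
    (forall B, B \notin X -> #|link F (B |: X)| <= c) ->
  #|link F X| <= (l - t).+1 * c.
Proof.
move=> sG FG tl QG XQ Hc; have /kpartitionsP[pQ cQ] := subsetP sG Q QG.
have [|W sW cW] := @exists_subset_card _ (Q :\: X) (l - t).+1.
  by have := cardsID X Q; rewrite setIC cQ; lia.
have sWQ : W \subset Q by apply: subset_trans sW (subsetDl _ _).
rewrite -cW -sum_nat_const.
apply: (@leq_trans (\sum_(B in W) #|link F (B |: X)|)).
  apply: leq_card_union => P; rewrite inE => /andP[PF sXP].
  have [PW|/set0Pn[B]] := eqVneq (P :&: W) set0.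
    have: P :&: Q \subset Q :\: W.
      apply/subsetP=> B; rewrite !inE => /andP[BP ->]; rewrite andbT.
      by move/setP/(_ B): PW; rewrite !inE BP /= => ->.
    move/subset_leq_card; rewrite cardsDS // cQ cW => le; have := FG P Q PF QG; lia.
  rewrite inE => /andP[BP BW]; exists B => //.
  by rewrite inE PF subUset sub1set BP.
apply: leq_sum => B BW; apply: Hc.
by have := subsetP sW B BW; rewrite inE => /andP[].
Qed.

(** As long as [#|X| < b], [X] is not a t-cover of [G], so some [Q] in [G] shares fewer than [t]
    blocks with it and [link_step] adds one block. After [b - #|X|] such steps the star bound
    applies. *)
Lemma link_bound F G k l t b X :
    F \subset kparts k -> G \subset kparts l -> cross t F G -> t <= l ->
    (forall Y, t_cover t Y G -> b <= #|Y|) -> #|X| <= b ->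
  #|link F X| <= (l - t).+1 ^ (b - #|X|) * star_bound #|T| k b.
Proof.
move=> sF sG FG tl minb; move eq_d: (b - #|X|) => d.
elim: d X eq_d => [|d IH] X eq_d leX.
  have -> : b = #|X| by lia.
  rewrite expn0 mul1n; apply: leq_trans (card_star_le k X).
  exact/subset_leq_card/link_star.
have : ~~ t_cover t X G by apply/negP => /minb; lia.
rewrite negb_forall => /existsP[Q]; rewrite negb_imply -ltnNge => /andP[QG XQ].
rewrite expnS -mulnA; apply: (link_step sG FG tl QG XQ) => B BX.
by apply: IH; rewrite cardsU1 BX; lia.
Qed.

(** Every member of [F] contains some [t]-subset of [Y], so the links of these subsets exhaust
    [F]. *)
Lemma t_cover_bound F t c Y :
    t_cover t Y F -> (forall X, #|X| = t -> #|link F X| <= c) ->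
  #|F| <= 'C(#|Y|, t) * c.
Proof.
move=> /forall_inP YF Hc; rewrite -cards_draws -sum_nat_const.
apply: (@leq_trans (\sum_(X in [set X : {set {set T}} | X \subset Y & #|X| == t]) #|link F X|)).
  apply: leq_card_union => P PF; have [X sX cX] := exists_subset_card (YF P PF).
  move: sX; rewrite subsetI => /andP[sXY sXP].
  by exists X; rewrite inE ?sXY ?cX ?eqxx // PF.
by apply: leq_sum => X; rewrite inE => /andP[_ /eqP /Hc].
Qed.

Lemma min_t_cover t F Y0 : t_cover t Y0 F ->
  exists2 Y, t_cover t Y F & forall Z, t_cover t Z F -> #|Y| <= #|Z|.
Proof.
move=> Y0F; case: (@arg_minnP _ Y0 (fun Y => t_cover t Y F) (fun Y : {set {set T}} => #|Y|) Y0F) => Y YF minY.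
by exists Y.
Qed.

Lemma t_cover_card t F Y P : t_cover t Y F -> P \in F -> t <= #|Y|.
Proof.
by move=> /forall_inP YF /YF /leq_trans -> //; rewrite subset_leq_card ?subsetIl.
Qed.

Lemma t_coverP t F Y : #|Y| = t -> reflect (forall P, P \in F -> Y \subset P) (t_cover t Y F).
Proof.
move=> cY; apply: (iffP forall_inP) => YF P /YF.
  by rewrite -cY => le; apply/setIidPl/eqP; rewrite eqEcard subsetIl.
by move/setIidPl->; rewrite cY.
Qed.

(** * Intersection with (t+1)-partitions *)

Lemma unique_completion t P Q :
  P \in kparts t.+1 -> Q \in kparts t.+1 -> t <= #|P :&: Q| -> P = Q.
Proof.
(* With at most one block left to choose, the star of the common blocks has at most one member. *)
move=> PT QT tPQ; have le1 : #|star [set: T] t.+1 (P :&: Q)| <= 1.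
  apply: leq_trans (card_star_le _ _) _; rewrite /star_bound; case: ltnP => // ltt.
  have -> : #|P :&: Q| = t by apply/eqP; rewrite eqn_leq tPQ andbT.
  by rewrite subSnn; case: (_ - t) => // m; rewrite stirling2_1.
by apply: (card_le1_eqP le1); rewrite inE ?PT ?QT ?subsetIl ?subsetIr.
Qed.

(** A partition contained in another partition of the same set equals it, so the differing block
    counts force some block of [Q] out of [P]. Sharing [t] of the [t.+1] blocks leaves room for only
    one. *)
Lemma missing_block k t P Q :
    P \in kparts k -> Q \in kparts t.+1 -> t.+1 < k -> t <= #|P :&: Q| ->
  exists B, [/\ B \in Q, B \notin P & Q :\ B \subset P].
Proof.
move=> /kpartitionsP[pP cP] /kpartitionsP[pQ cQ] tk tPQ.
have /subsetPn[B BQ BP] : ~~ (Q \subset P).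
  apply/negP => /(partition_sub_eq pP pQ) PQ.
  by move: tk; rewrite -cP PQ cQ ltnn.
exists B; split=> //; apply/subsetP=> A /setD1P[AB AQ]; apply: contraT => AP.
have: #|[set A; B]| <= #|Q :\: P|.
  by apply/subset_leq_card/subsetP=> C /set2P[] ->; rewrite inE ?AP ?BP.
rewrite cards2 AB => le2; have := leq_add tPQ le2.
by rewrite setIC cardsID cQ addn2 ltnn.
Qed.

Lemma block_mem_or_sub P Q D B C :
    partition P D -> partition Q D -> Q :\ B \subset P -> C \in P ->
  C \in Q \/ C \subset B.
Proof.
move=> pP pQ sQP CP; case CQ: (C \in Q); [by left | right].
apply/subsetP=> y yC; have yQ : y \in cover Q.
  by rewrite (cover_partition pQ) (subsetP (partitionS pP CP)).
have [<-|AB] := eqVneq (pblock Q y) B; first by rewrite mem_pblock.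
have AP : pblock Q y \in P by rewrite (subsetP sQP) // !inE AB pblock_mem.
by rewrite (partition_eq pP CP AP yC) ?pblock_mem // mem_pblock in CQ.
Qed.

(** Since [Q] and [R] differ, [unique_completion] provides a block [A] of [R] other than [C] that is
    not in [Q]. It lies in [P], hence inside [B]. If [A] were not [C'], it would also lie in [P'],
    hence inside [B'], which is disjoint from [B]. So [A] is [C']. *)
Lemma missing_blocks_nested t k Q R P P' B B' C C' :
    Q \in kparts t.+1 -> R \in kparts t.+1 -> Q != R ->
    P \in kparts k -> P' \in kparts k -> B \in Q -> B' \in Q -> B != B' -> C \in R ->
    Q :\ B \subset P -> Q :\ B' \subset P' -> R :\ C \subset P -> R :\ C' \subset P' ->
  [/\ C' != C, C' \notin Q & C' \subset B].
Proof.
move=> QT RT QR /kpartitionsP[pP _] /kpartitionsP[pP' _] BQ B'Q BB' CR sQP sQP' sRP sRP'.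
have /kpartitionsP[pQ _] := QT; have /kpartitionsP[pR cR] := RT.
have /subsetPn[A /setD1P[AC AR] AQ] : ~~ (R :\ C \subset Q).
  apply: contra QR => sRQ; apply/eqP/(unique_completion QT RT).
  have cRC : #|R :\ C| = t by move: cR; rewrite (cardsD1 C) CR; case.
  by rewrite -cRC subset_leq_card // subsetI sRQ subD1set.
have AB : A \subset B.
  have AP : A \in P by rewrite (subsetP sRP) // !inE AC.
  by case: (block_mem_or_sub pP pQ sQP AP) => // AQ'; rewrite AQ' in AQ.
suff AC' : A = C' by rewrite -AC'.
apply/eqP; apply: contraT => AC'.
have AP' : A \in P' by rewrite (subsetP sRP') // !inE AC'.
case: (block_mem_or_sub pP' pQ sQP' AP') => [AQ'|AB']; first by rewrite AQ' in AQ.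
have /set0Pn[y yA] := partition_neq0 pR AR.
by rewrite (partition_eq pQ BQ B'Q (subsetP AB y yA) (subsetP AB' y yA)) eqxx in BB'.
Qed.

(** If [P] and [P'] omitted different blocks [B] and [B'] of [Q], exchanging roles in
    [missing_blocks_nested] would give both inclusions between [C] and [B'], and also that [C] is
    not in [Q]. But [B'] is in [Q]. *)
Lemma common_trace t k F G Q R :
    F \subset kparts k -> G \subset kparts t.+1 -> cross t F G -> t.+1 < k ->
    F != set0 -> Q \in G -> R \in G -> Q != R ->
  exists2 X : {set {set T}}, #|X| = t & t_cover t X F.
Proof.
move=> /subsetP sF /subsetP sG FG tk /set0Pn[P PF] QG RG QR.
have [B [BQ _ sQP]] := missing_block (sF _ PF) (sG _ QG) tk (FG _ _ PF QG).
have [C [CR _ sRP]] := missing_block (sF _ PF) (sG _ RG) tk (FG _ _ PF RG).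
have cX : #|Q :\ B| = t.
  by have /kpartitionsP[_] := sG _ QG; rewrite (cardsD1 B) BQ; case.
exists (Q :\ B) => //; apply/(t_coverP F cX) => P' P'F.
have [B' [B'Q _ sQP']] := missing_block (sF _ P'F) (sG _ QG) tk (FG _ _ P'F QG).
have [C' [C'R _ sRP']] := missing_block (sF _ P'F) (sG _ RG) tk (FG _ _ P'F RG).
have [-> //|BB'] := eqVneq B B'; exfalso.
have [C'C _ _] := missing_blocks_nested (sG _ QG) (sG _ RG) QR (sF _ PF) (sF _ P'F)
  BQ B'Q BB' CR sQP sQP' sRP sRP'.
have B'B : B' != B by rewrite eq_sym.
have [_ CQ sCB'] := missing_blocks_nested (sG _ QG) (sG _ RG) QR (sF _ P'F) (sF _ PF)
  B'Q BQ B'B C'R sQP' sQP sRP' sRP.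
have RQ : R != Q by rewrite eq_sym.
have CC' : C != C' by rewrite eq_sym.
have [_ _ sB'C] := missing_blocks_nested (sG _ RG) (sG _ QG) RQ (sF _ PF) (sF _ P'F)
  CR C'R CC' BQ sRP sRP' sQP sQP'.
suff CB' : C = B' by rewrite CB' B'Q in CQ.
by apply/eqP; rewrite eqEsubset sCB'.
Qed.

(** * The dichotomy for two families above the threshold *)

Section Threshold.
Variables (t j : nat).
Let n := #|T|.
Let q := (t.+1 * j.+1)%N.
Hypotheses (j2 : 1 < j) (qn : q ^ j.+1 <= 2 ^ (n - t).-1).

Lemma threshold_size : t + j.+1 < n.
Proof.
have jq : j < q by rewrite /q; nia.
have := @growth_size (n - t) j j q j2 (leqnn j) jq qn; lia.
Qed.

Lemma star_bound_lt k x : t.+1 < k -> k <= t + j -> t < x -> x <= k ->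
  q ^ (x - t) * star_bound n k x < stirling2 (n - t) (k - t).
Proof.
move=> tk kj tx xk; have jq : j < q by rewrite /q; nia.
have i2 : 1 < k - t by lia.
have ij : k - t <= j by lia.
have := @star_bound_growth (n - t) (k - t) j q i2 ij jq qn (x - t).
have -> : star_bound (n - t) (k - t) (x - t) = star_bound n k x.
  rewrite /star_bound; have -> : (x - t < k - t) = (x < k) by lia.
  have -> : n - t - (x - t) = n - x by lia.
  by have -> : k - t - (x - t) = k - x by lia.
by apply; lia.
Qed.

Lemma star_bound_base k : t < k -> star_bound n k t = stirling2 (n - t) (k - t).
Proof. by rewrite /star_bound => ->. Qed.

Lemma star_base_gt0 k : t < k -> k <= t + j -> 0 < stirling2 (n - t) (k - t).
Proof. by move=> tk kj; have := threshold_size => ?; apply: stirling2_gt0; lia. Qed.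

(** Choosing a [t]-set inside the cover of [F] costs a power of t+1. Branching against [G] costs a
    power of l-t+1, relaxed to j+1 so that both families share one base. *)
Lemma cross_bound F G k l Y b :
    F \subset kparts k -> G \subset kparts l -> cross t F G ->
    t < l -> l <= t + j -> t_cover t Y F -> t <= #|Y| -> t <= b ->
    (forall Z, t_cover t Z G -> b <= #|Z|) ->
  #|F| <= t.+1 ^ (#|Y| - t) * (j.+1 ^ (b - t) * star_bound n k b).
Proof.
move=> sF sG FG tl lj YF tY tb minb.
apply: leq_trans (t_cover_bound YF (c := j.+1 ^ (b - t) * star_bound n k b) _) _.
  move=> X cX; have := link_bound sF sG FG (ltnW tl) minb (X := X).
  rewrite cX => /(_ tb) /leq_trans -> //; rewrite leq_mul2r; apply/orP; right.
  by case: (b - t) => // d; rewrite leq_exp2r //; lia.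
by rewrite leq_mul2r; apply/orP; right; rewrite -{1}(subnKC tY) leq_bin_exp.
Qed.

Definition common_t_set F G :=
  exists X, [/\ #|X| = t, forall P, P \in F -> X \subset P & forall Q, Q \in G -> X \subset Q].

(** The last hypothesis controls the factor of [G]: either [star_bound_lt] applies to [l], or a
    t-cover of [F] of size [t] forces the minimal cover [A] to have size [t]. *)
Lemma cross_dichotomy_cover F G k l :
    F \subset kparts k -> G \subset kparts l -> cross t F G ->
    t.+1 < k -> k <= t + j -> t < l -> l <= t + j ->
    F != set0 -> G != set0 ->
    t.+1 < l \/ (exists2 X : {set {set T}}, #|X| = t & t_cover t X F) ->
  common_t_set F G \/
  #|F| * #|G| < stirling2 (n - t) (k - t) * stirling2 (n - t) (l - t).
Proof.
move=> sF sG FG tk kj tl lj /set0Pn[P PF] /set0Pn[Q QG] side.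
have /kpartitionsP[pP cP] := subsetP sF P PF.
have /kpartitionsP[pQ cQ] := subsetP sG Q QG.
have QF : t_cover t Q F by apply/forall_inP => R RF; rewrite setIC FG.
have PG : t_cover t P G by apply/forall_inP => R RG; rewrite FG.
have [A AF minA] := min_t_cover QF; have [B BG minB] := min_t_cover PG.
have tA := t_cover_card AF PF; have tB := t_cover_card BG QG.
have Al : #|A| <= l by rewrite -cQ minA.
have Bk : #|B| <= k by rewrite -cP minB.
have FF := cross_bound sF sG FG tl lj AF tA tB minB.
have GG := cross_bound sG sF (cross_sym FG) (ltnW tk) kj BG tB tA minA.
have Sk := star_base_gt0 (ltnW tk) kj; have Sl := star_base_gt0 tl lj.
(* The bounds are regrouped crosswise: the (j+1)-power in the bound of [F] and the (t+1)-power in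
   the bound of [G] both have exponent [#|B| - t] and merge into a power of [q]; likewise for
   [A]. *)
have prod : #|F| * #|G| <=
    (q ^ (#|B| - t) * star_bound n k #|B|) * (q ^ (#|A| - t) * star_bound n l #|A|).
  apply: leq_trans (leq_mul FF GG) _; rewrite /q !expnMn.
  move: (t.+1 ^ (#|A| - t)) (t.+1 ^ (#|B| - t)) (j.+1 ^ (#|A| - t)) (j.+1 ^ (#|B| - t)) => a b c d.
  move: (star_bound n k _) (star_bound n l _) => u v.
  by rewrite -[b * d * u]mulnA -[a * c * v]mulnA mulnACA [b * _ * _]mulnACA [b * a]mulnC.
have Ble : q ^ (#|B| - t) * star_bound n k #|B| <= stirling2 (n - t) (k - t) ?= iff (#|B| == t).
  apply/leqifP; case: eqVneq => [->|Bt]; first by rewrite subnn mul1n star_bound_base // ltnW.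
  by apply: star_bound_lt => //; rewrite ltn_neqAle eq_sym Bt.
have Ale : q ^ (#|A| - t) * star_bound n l #|A| <= stirling2 (n - t) (l - t) ?= iff (#|A| == t).
  apply/leqifP; case: eqVneq => [->|At]; first by rewrite subnn mul1n star_bound_base.
  case: side => [tl2|[X cX XF]]; last first.
    by have := minA X XF; rewrite cX leqNgt ltn_neqAle eq_sym At tA.
  by apply: star_bound_lt => //; rewrite ltn_neqAle eq_sym At.
have [At|At] := eqVneq #|A| t; last first.
  right; apply: leq_ltn_trans prod _.
  apply: (@leq_ltn_trans (stirling2 (n - t) (k - t) * (q ^ (#|A| - t) * star_bound n l #|A|))).
    by rewrite leq_mul2r Ble orbT.
  by rewrite ltn_pmul2l // (ltn_leqif Ale).
have [Bt|Bt] := eqVneq #|B| t; last first.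
  right; apply: leq_ltn_trans prod _.
  apply: (@leq_ltn_trans (q ^ (#|B| - t) * star_bound n k #|B| * stirling2 (n - t) (l - t))).
    by rewrite leq_mul2l Ale orbT.
  by rewrite ltn_pmul2r // (ltn_leqif Ble).
have [AG|] := boolP (t_cover t A G).
  by left; exists A; split=> //; [exact/(t_coverP F At) | exact/(t_coverP G At)].
(* Both minimal covers have size [t], but [A] fails for some [R] in [G]. Every member of [F]
   contains [A], so one branching step against [R] makes the bound on [F] strict. *)
rewrite negb_forall => /existsP[R]; rewrite negb_imply -ltnNge => /andP[RG AR].
right; have FA : F = link F A.
  apply/setP=> R'; rewrite inE; case R'F: (R' \in F) => //=.
  by rewrite (elimT (t_coverP F At) AF).
have Flt : #|F| < stirling2 (n - t) (k - t).
  apply: leq_ltn_trans (star_bound_lt tk kj (ltnSn t) (ltnW tk)).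
  rewrite subSnn expn1 FA; apply: (@leq_trans ((l - t).+1 * star_bound n k t.+1)).
    apply: (link_step sG FG (ltnW tl) RG AR) => C CA.
    apply: leq_trans (subset_leq_card (link_star _ sF)) _.
    by apply: leq_trans (card_star_le _ _) _; rewrite cardsU1 CA At.
  rewrite leq_mul2r; apply/orP; right; apply: (@leq_trans j.+1); last by rewrite leq_pmull.
  by rewrite ltnS leq_subLR.
apply: (@leq_ltn_trans (#|F| * stirling2 (n - t) (l - t))); last by rewrite ltn_pmul2r.
rewrite leq_mul2l; apply/orP; right; apply: leq_trans GG _.
by rewrite At Bt subnn !expn0 !mul1n star_bound_base.
Qed.

Lemma common_t_set_sym F G : common_t_set F G -> common_t_set G F.
Proof. by case=> X [? ? ?]; exists X. Qed.

(** Each member of [F] keeps all blocks of [Q] but one and partitions that one into k-t parts. If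
    two members break different blocks, two terms of the sum over blocks of [Q] are positive, and
    superadditivity is strict. *)
Lemma cross_dichotomy_single F Q k :
    F \subset kparts k -> Q \in kparts t.+1 -> cross t F [set Q] ->
    t.+1 < k -> F != set0 ->
  common_t_set F [set Q] \/ #|F| < stirling2 (n - t) (k - t).
Proof.
move=> /subsetP sF QT FQ tk /set0Pn[P PF].
have [pQ cQ] := kpartitionsP _ _ _ QT.
have missing R : R \in F -> exists B, [/\ B \in Q, B \notin R & Q :\ B \subset R].
  by move=> RF; apply: (missing_block (sF _ RF) QT tk); rewrite FQ ?set11.
have [B [BQ BP sQP]] := missing P PF.
have cX C : C \in Q -> #|Q :\ C| = t by move=> CQ; move: cQ; rewrite (cardsD1 C) CQ; case.
have [sB|] := boolP [forall R in F, Q :\ B \subset R].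
  left; exists (Q :\ B); split; [exact: cX | exact/forall_inP | move=> R].
  by rewrite inE => /eqP->; rewrite subD1set.
rewrite negb_forall => /existsP[R]; rewrite negb_imply => /andP[RF sBR].
have [C [CQ CR sQR]] := missing R RF.
have BC : B != C by apply: contraNneq sBR => ->.
have Bpred A : A \in Q -> #|A|.-1.+1 = #|A|.
  by move=> AQ; rewrite prednK // card_gt0 (partition_neq0 pQ).
have cstar A : A \in Q -> #|star [set: T] k (Q :\ A)| = stirling2 #|A|.-1.+1 (k - t).
  move=> AQ; rewrite card_star ?subsetT ?(partition_sub pQ) ?subD1set ?cX //; last exact: ltnW (ltnW tk).
  rewrite (cover_partition (partitionD1 pQ AQ)) Bpred //.
  have := subset_leq_card (subsetT A); rewrite cardsDS ?subsetT // => leA.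
  by rewrite subKn.
right; apply: (@leq_ltn_trans (\sum_(A in Q) stirling2 #|A|.-1.+1 (k - t))).
  rewrite -(eq_bigr _ cstar); apply: leq_card_union => S SF.
  have [A [AQ _ sQS]] := missing S SF; exists A => //.
  by rewrite inE sF.
(* [Q] has t+1 blocks, so lowering each block size by one removes t+1 points in total. *)
have -> : n - t = (\sum_(A in Q) #|A|.-1).+1.
  have : n = \sum_(A in Q) #|A|.-1 + t.+1.
    rewrite -cQ -sum1_card -big_split /= /n -cardsT (card_partition pQ).
    by apply: eq_bigr => A AQ; rewrite addn1 Bpred.
  by move=> ->; rewrite addnS -addSn addnK.
apply: (@sum_stirling2_lt _ Q _ _ B C) => //; first by rewrite ltn_subRL addn1.
  by rewrite -cstar //; apply/card_gt0P; exists P; rewrite inE sF.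
by rewrite -cstar //; apply/card_gt0P; exists R; rewrite inE sF.
Qed.

Lemma cross_dichotomy_lt F G k l :
    F \subset kparts k -> G \subset kparts l -> cross t F G ->
    t.+1 < k -> k <= t + j -> t < l -> l <= t + j -> F != set0 -> G != set0 ->
  common_t_set F G \/
  #|F| * #|G| < stirling2 (n - t) (k - t) * stirling2 (n - t) (l - t).
Proof.
move=> sF sG FG tk kj tl lj F0 G0.
have [tl2|l1] := ltnP t.+1 l; first by apply: cross_dichotomy_cover; rewrite //; left.
have {l1} lE : l = t.+1 by apply/eqP; rewrite eqn_leq l1.
subst l; have [Q QG] := set0Pn _ G0.
have [sGQ|/subsetPn[R RG]] := boolP (G \subset [set Q]).
  have GQ : G = [set Q] by apply/eqP; rewrite eqEsubset sGQ sub1set.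
  subst G; rewrite cards1 muln1 subSnn stirling2_1; last by have := threshold_size; lia.
  rewrite muln1; apply: cross_dichotomy_single => //.
  exact: (subsetP sG).
rewrite inE eq_sym => QR.
by apply: cross_dichotomy_cover => //; right; apply: (common_trace sF sG FG tk F0 QG RG QR).
Qed.

Lemma cross_dichotomy F G k l :
    F \subset kparts k -> G \subset kparts l -> cross t F G ->
    t < k -> k <= t + j -> t < l -> l <= t + j -> F != set0 -> G != set0 ->
  common_t_set F G \/
  #|F| * #|G| < stirling2 (n - t) (k - t) * stirling2 (n - t) (l - t).
Proof.
move=> sF sG FG tk kj tl lj F0 G0.
have [tk2|k1] := ltnP t.+1 k; first exact: cross_dichotomy_lt.
have [tl2|l1] := ltnP t.+1 l.
  have [cFG|lt] := cross_dichotomy_lt sG sF (cross_sym FG) tl2 lj tk kj G0 F0.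
    by left; apply: common_t_set_sym.
  by right; rewrite mulnC [ltnRHS]mulnC.
(* In the remaining case k = l = t+1, every member of [F] equals every member of [G], so any [t]
   blocks of this one partition serve. *)
left; have kE : k = t.+1 by apply/eqP; rewrite eqn_leq k1.
have lE : l = t.+1 by apply/eqP; rewrite eqn_leq l1.
subst k l; have [P PF] := set0Pn _ F0; have [Q QG] := set0Pn _ G0.
have eqFG R S : R \in F -> S \in G -> R = S.
  by move=> RF SG; apply: (unique_completion (subsetP sF _ RF) (subsetP sG _ SG)); apply: FG.
have [X sX cX] := exists_subset_card (FG _ _ PF QG).
have {sX} sX : X \subset Q by apply: subset_trans sX (subsetIr _ _).
exists X; split=> // R RF; first by rewrite (eqFG _ _ RF QG).
by rewrite -(eqFG _ _ PF RF) (eqFG _ _ PF QG).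
Qed.

(** * Families with a common t-set, and the case of equality *)

Lemma common_bound F k X :
    F \subset kparts k -> t < k -> #|X| = t -> (forall P, P \in F -> X \subset P) ->
  F \subset star [set: T] k X /\ #|F| <= stirling2 (n - t) (k - t).
Proof.
move=> sF tk cX XF; have sFX : F \subset star [set: T] k X.
  by apply/subsetP=> P PF; rewrite inE (subsetP sF) ?XF.
split=> //; apply: leq_trans (subset_leq_card sFX) _.
by apply: leq_trans (card_star_le _ _) _; rewrite cX star_bound_base.
Qed.

(** A non-singleton block in [X] would leave fewer than n-t points for the other k-t blocks. Since
    k-t >= 2, the Stirling number strictly detects the loss. *)
Lemma common_extremal F k X :
    F \subset kparts k -> t.+1 < k -> k <= t + j -> #|X| = t ->
    (forall P, P \in F -> X \subset P) -> #|F| = stirling2 (n - t) (k - t) ->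
  partition X (cover X) /\ #|cover X| = t.
Proof.
move=> sF tk kj cX XF cF; have Sk := star_base_gt0 (ltnW tk) kj.
have [sFX _] := common_bound sF (ltnW tk) cX XF.
have /card_gt0P[P PF] : 0 < #|F| by rewrite cF.
have /kpartitionsP[pP cP] := subsetP sF P PF.
have pX := partition_sub pP (XF P PF); split=> //.
have tX : t <= #|cover X| by rewrite -{1}cX leq_card_partition.
apply/eqP; rewrite eqn_leq tX andbT leqNgt; apply/negP => ltX.
have := subset_leq_card sFX; rewrite cF card_star ?subsetT ?cX ?cardsT //; last by lia.
apply/negP; rewrite -ltnNge; have := threshold_size => tn.
by apply: ltn_stirling2; rewrite -/n; lia.
Qed.

(** Otherwise every member contains the larger set [X :|: Y], whose star is too small by
    [star_bound_lt]. *)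
Lemma common_unique F k X Y :
    F \subset kparts k -> t.+1 < k -> k <= t + j -> #|X| = t -> #|Y| = t ->
    (forall P, P \in F -> X \subset P) -> (forall P, P \in F -> Y \subset P) ->
    #|F| = stirling2 (n - t) (k - t) -> X = Y.
Proof.
move=> sF tk kj cX cY XF YF cF; apply/eqP; apply: contraT => XY.
have Sk := star_base_gt0 (ltnW tk) kj; have q0 : 0 < q by [].
have /card_gt0P[P PF] : 0 < #|F| by rewrite cF.
have /kpartitionsP[pP cP] := subsetP sF P PF.
have XYF R : R \in F -> X :|: Y \subset R by move=> RF; rewrite subUset XF ?YF.
have leXY : #|X :|: Y| <= k by rewrite -cP subset_leq_card ?XYF.
have ltXY : t < #|X :|: Y|.
  rewrite ltnNge; apply: contra XY => leXY'.
  have eX : X = X :|: Y by apply/eqP; rewrite eqEcard subsetUl cX.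
  by rewrite eq_sym eqEcard eX subsetUr -eX cX cY /=.
have sFX : F \subset star [set: T] k (X :|: Y).
  by apply/subsetP=> R RF; rewrite inE (subsetP sF) ?XYF.
have := star_bound_lt tk kj ltXY leXY; rewrite ltnNge -cF => /negP[].
apply: leq_trans (subset_leq_card sFX) (leq_trans (card_star_le _ _) _).
by rewrite leq_pmull // expn_gt0 q0.
Qed.

End Threshold.
End CrossIntersecting.

(** * Several families *)

Lemma INR_expn x m : INR (x ^ m) = pow (INR x) m.
Proof. by elim: m => [|m IH] //; rewrite expnS -multE mult_INR IH. Qed.

(** With j = k-t and q = (t+1)(j+1), the threshold reads (j+1) log2 q <= n-t-1; exponentiating gives
    the claim. *)
Lemma Lbound_expn n k t : t.+1 < k -> Rle (Lbound k t) (INR n) ->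
  (t.+1 * (k - t).+1) ^ (k - t).+1 <= 2 ^ (n - t).-1.
Proof.
move=> tk; set j := k - t; set q := t.+1 * j.+1.
have j1 : 1 < j by rewrite /j ltn_subRL addn1.
have -> : k = j + t by rewrite subnK // ltnW // ltnW.
have qE : INR q = ((INR t + 1) * (INR j + 1))%coqR by rewrite -!S_INR -mult_INR.
have lnq : Rle 0 (ln (INR q)).
  rewrite -ln_1; apply/Rlt_le/ln_increasing; first lra.
  by apply: (lt_INR 1); apply/leP; rewrite /q; nia.
have q0 : Rlt 0 (INR q) by apply: (lt_INR 0); apply/leP.
have l2 : Rlt 0 (ln 2) by rewrite -ln_1; apply: ln_increasing; lra.
have j0 : Rle 0 (INR j) := pos_INR j.
rewrite /Lbound /log2 -plusE plus_INR.
have -> : (INR j + INR t - INR t + 1)%coqR = (INR j + 1)%coqR by ring.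
rewrite -qE => H.
have d0 : Rle 0 (ln (INR q) / ln 2).
  by apply: Rmult_le_pos => //; apply/Rlt_le/Rinv_0_lt_compat.
(* The logarithmic term is nonnegative, so n >= t+1 and the natural-number subtraction in
   [(n - t).-1] is exact. *)
have tn : t.+1 <= n.
  by apply/leP/INR_le; rewrite S_INR; nra.
have mE : INR (n - t).-1 = (INR n - INR t - 1)%coqR.
  have {2}-> : n = ((n - t).-1 + t.+1)%N by lia.
  by rewrite -plusE plus_INR S_INR; lra.
apply/leP/INR_le; rewrite !INR_expn; apply: Rnot_lt_le => lt.
have := ln_increasing _ _ (pow_lt 2 (n - t).-1 Rlt_0_2) lt.
rewrite !ln_pow //; last exact: Rlt_0_2.
rewrite mE S_INR; apply: Rle_not_lt.
have -> : ((INR j + 1) * ln (INR q) = ((INR j + 1) * (ln (INR q) / ln 2)) * ln 2)%coqR by field; lra.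
by apply: Rmult_le_compat_r; lra.
Qed.

Section ManyFamilies.
Variables (T : finType) (r t j : nat) (k : nat -> nat) (F : nat -> {set {set {set T}}}).
Let n := #|T|.
Let S i := stirling2 (n - t) (k i - t).
Hypotheses (r2 : 1 < r) (j2 : 1 < j) (qn : (t.+1 * j.+1) ^ j.+1 <= 2 ^ (n - t).-1).
Hypotheses (tk : forall i, i < r -> t < k i) (kj : forall i, i < r -> k i <= t + j).
Hypothesis k0 : k 0 = t + j.
Hypothesis sF : forall i, i < r -> F i \subset kpartitions [set: T] (k i).
Hypothesis F0 : forall i, i < r -> F i != set0.
Hypothesis crossF : forall i l, i < r -> l < r -> i != l -> cross t (F i) (F l).

Lemma bound_gt0 i : i < r -> 0 < S i.
Proof. by move=> ir; apply: (star_base_gt0 j2 qn (tk ir) (kj ir)). Qed.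

Lemma families_pair i l : i < r -> l < r -> i != l ->
  common_t_set t (F i) (F l) \/ #|F i| * #|F l| < S i * S l.
Proof.
move=> ir lr il; apply: (cross_dichotomy j2 qn (sF ir) (sF lr) (crossF ir lr il));
  by rewrite ?tk ?kj ?F0.
Qed.

(** A family above its bound has no common [t]-set with any other, so each pair containing it
    satisfies the strict product bound and every other family is below its own bound. One such pair
    times the remaining families gives the claim. *)
Lemma big_family_lt i : i < r -> S i < #|F i| ->
  \prod_(l < r) #|F l| < \prod_(l < r) S l.
Proof.
move=> ir Si.
have pair l : l < r -> l != i -> #|F i| * #|F l| < S i * S l.
  move=> lr li; have il : i != l by rewrite eq_sym.
  have [[X [cX XF _]]|//] := families_pair ir lr il.
  have [_] := common_bound (sF ir) (tk ir) cX XF.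
  by rewrite leqNgt Si.
have small l : l < r -> l != i -> #|F l| < S l.
  move=> lr li; have lt := pair l lr li; rewrite ltnNge; apply/negP => ge.
  by move: lt; rewrite ltnNge leq_mul // ltnW.
have [l lr li] : exists2 l, l < r & l != i.
  by case: (i) => [|i']; [exists 1 | exists 0 => //; apply: ltnW].
pose oi := Ordinal ir; pose ol := Ordinal lr.
have oli : ol != oi by rewrite -val_eqE.
have split2 (f : nat -> nat) : \prod_(m < r) f m
    = f i * f l * \prod_(m < r | (m != oi) && (m != ol)) f m.
  by rewrite (bigD1 oi) //= (bigD1 ol) //= mulnA.
rewrite (split2 (fun m => #|F m|)) split2.
apply: (@leq_ltn_trans (#|F i| * #|F l| * \prod_(m < r | (m != oi) && (m != ol)) S m)).
  rewrite leq_mul2l; apply/orP; right; apply: leq_prod => m /andP[mi _].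
  by apply/ltnW/small.
rewrite ltn_pmul2r ?pair //; apply: prodn_cond_gt0 => m _; exact: bound_gt0.
Qed.

Lemma families_small : \prod_(l < r) S l <= \prod_(l < r) #|F l| ->
  forall i, i < r -> #|F i| <= S i.
Proof.
by move=> ge i ir; rewrite leqNgt; apply/negP => /(big_family_lt ir); rewrite ltnNge ge.
Qed.

(** If the opposite inequality held, [big_family_lt] would rule out any family above its bound, and
    the products compare factor by factor. *)
Lemma families_le : \prod_(l < r) #|F l| <= \prod_(l < r) S l.
Proof.
case/orP: (leq_total (\prod_(l < r) #|F l|) (\prod_(l < r) S l)) => // ge.
by apply: leq_prod => i _; apply: families_small.
Qed.

Lemma families_eq_card : \prod_(l < r) #|F l| = \prod_(l < r) S l ->
  forall i, i < r -> #|F i| = S i.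
Proof.
move=> eqp i ir; have small := families_small (eq_leq (esym eqp)).
apply/eqP; rewrite eqn_leq small //= leqNgt; apply/negP => lt.
have: \prod_(l < r) #|F l| < \prod_(l < r) S l.
  have split1 (f : nat -> nat) : \prod_(m < r) f m
      = f i * \prod_(m < r | m != Ordinal ir) f m by rewrite (bigD1 (Ordinal ir)).
  rewrite (split1 (fun m => #|F m|)) split1.
  apply: (@leq_ltn_trans (#|F i| * \prod_(m < r | m != Ordinal ir) S m)).
    by rewrite leq_mul2l; apply/orP; right; apply: leq_prod => m _; apply: small.
  by rewrite ltn_pmul2r //; apply: prodn_cond_gt0 => m _; apply: bound_gt0.
by rewrite eqp ltnn.
Qed.

(** Family 0 serves as a hub. Equality in each factor leaves only the common [t]-set alternative for
    the pair of 0 and [i]. As [k 0] is at least t+2, the common [t]-set of [F 0] is unique, so a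
    single [X] works for all [i]. *)
Lemma families_extremal : \prod_(l < r) #|F l| = \prod_(l < r) S l ->
  exists X : {set {set T}}, [/\ partition X (cover X), #|X| = t, #|cover X| = t &
    forall i, i < r -> F i = star [set: T] (k i) X].
Proof.
move=> /families_eq_card eqc; have r0 : 0 < r by apply: ltnW.
have tk0 : t.+1 < k 0 by rewrite k0 -[t.+2]addn2 leq_add2l.
have pair i : i < r -> i != 0 -> common_t_set t (F 0) (F i).
  move=> ir i0; have := families_pair r0 ir; rewrite eq_sym => /(_ i0) [//|].
  by rewrite !eqc // ltnn.
have [X [cX XF0 _]] := pair 1 r2 isT.
have [pX cvX] := common_extremal j2 qn (sF r0) tk0 (kj r0) cX XF0 (eqc 0 r0).
exists X; split=> // i ir.
have XFi P : P \in F i -> X \subset P.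
  have [->|i0] := eqVneq i 0; first exact: XF0.
  have [Y [cY YF0 YFi]] := pair i ir i0.
  by rewrite (common_unique j2 qn (sF r0) tk0 (kj r0) cX cY XF0 YF0 (eqc 0 r0)); apply: YFi.
have [sFX _] := common_bound (sF ir) (tk ir) cX XFi.
apply/eqP; rewrite eqEcard sFX eqc // /S card_star ?subsetT ?cX ?cardsT ?cvX //=.
exact: ltnW (tk ir).
Qed.

End ManyFamilies.

(** Arbitrary members of the other, nonempty families complete [P] and [Q] to a full selection,
    whose intersection lies in [P :&: Q]. *)
Lemma cross_pairs n r t (F : nat -> {set {set {set 'I_n}}}) i l :
    cross_t_intersecting r t F -> (forall m, m < r -> F m != set0) ->
    i < r -> l < r -> i != l -> cross t (F i) (F l).
Proof.
move=> crossF F0 ir lr il P Q PF QF.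
have choice m : exists R, (m < r) ==> (R \in F m).
  (* Indices beyond [r] carry no constraint; [set0] is a dummy value there. *)
  case mr: (m < r); last by exists set0.
  by have /set0Pn[R RF] := F0 m mr; exists R; rewrite RF.
pose G m := if m == i then P else if m == l then Q else xchoose (choice m).
have Gin m : m < r -> G m \in F m.
  move=> mr; rewrite /G; case: (m =P i) => [->//|_]; case: (m =P l) => [->//|_].
  exact: implyP (xchooseP (choice m)) mr.
apply: leq_trans (crossF G Gin) _; apply/subset_leq_card; rewrite subsetI.
have := bigcap_inf (P := xpredT) (Ordinal ir) (F := fun m : 'I_r => G m) isT.
have := bigcap_inf (P := xpredT) (Ordinal lr) (F := fun m : 'I_r => G m) isT.
have -> : G (Ordinal ir) = P by rewrite /G eqxx.
have -> : G (Ordinal lr) = Q by rewrite /G /= [l == i]eq_sym (negPf il) eqxx.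
by move=> -> ->.
Qed.

Theorem theorem1p3 (n r t : nat) (k : nat -> nat)
    (F : nat -> {set {set {set 'I_n}}}) :
  2 <= r ->
  (forall i j, i <= j -> j < r -> k j <= k i) ->
  (forall i, i < r -> t.+1 <= k i) ->
  t.+2 <= k 0 ->
  Rle (Lbound (k 0) t) (INR n) ->
  (forall i, i < r -> F i \subset Pi n (k i)) ->
  cross_t_intersecting r t F ->
  (\prod_(i < r) #|F i| <= \prod_(i < r) stirling2 (n - t) (k i - t))%N /\
  ((\prod_(i < r) #|F i| = \prod_(i < r) stirling2 (n - t) (k i - t))%N <->
   exists X : {set {set 'I_n}},
     [/\ is_partition X, #|X| = t, (forall B, B \in X -> #|B| = 1)
       & forall i, i < r -> F i = [set P in Pi n (k i) | X \subset P]]).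
Proof.
move=> r2 kmono tk tk0 Ln sF crossF.
have qn := Lbound_expn tk0 Ln; set j := k 0 - t in qn.
have j2 : 1 < j by rewrite /j ltn_subRL addn1.
have k0 : k 0 = t + j by rewrite /j subnKC // ltnW // ltnW.
have kj i : i < r -> k i <= t + j by move=> ir; rewrite -k0 kmono.
rewrite -(card_ord n) in qn.
have Spos : 0 < \prod_(i < r) stirling2 (n - t) (k i - t).
  apply: prodn_gt0 => i; rewrite -{1}(card_ord n).
  by apply: (star_base_gt0 j2 qn); rewrite ?tk ?kj.
have singletons X : is_partition X -> #|X| = t -> (forall B, B \in X -> #|B| = 1) ->
    forall i, i < r -> #|star [set: 'I_n] (k i) X| = stirling2 (n - t) (k i - t).
  move=> /andP[tX X0] cX X1 i ir; have pX : partition X (cover X) by rewrite /partition eqxx tX.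
  rewrite card_star ?subsetT ?cX ?(ltnW (tk i ir)) // cardsT card_ord.
  by rewrite (card_partition pX) (eq_bigr _ X1) sum1_card cX.
(* If some family is empty, the left product is 0 and the right one positive. A star of [t]
   singletons is nonempty, so both sides of the equivalence fail. *)
have [F0|] := boolP [forall i : 'I_r, F i != set0]; last first.
  rewrite negb_forall => /existsP[i]; rewrite negbK => /eqP Fi.
  have -> : \prod_(i < r) #|F i| = 0 by rewrite (bigD1 i) //= Fi cards0.
  split=> //; split=> [E|[X [pX cX X1 FX]]]; first by rewrite -E in Spos.
  have := singletons X pX cX X1 i (ltn_ord i); have /= := FX i (ltn_ord i).
  rewrite Fi => E; rewrite /star -E cards0 => S0.
  by rewrite (bigD1 i) //= -S0.
have {}F0 i : i < r -> F i != set0 by move=> ir; apply: (forallP F0 (Ordinal ir)).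
have crossP i l : i < r -> l < r -> i != l -> cross t (F i) (F l).
  exact: cross_pairs.
have := families_le r2 j2 qn tk kj sF F0 crossP.
have := families_extremal r2 j2 qn tk kj k0 sF F0 crossP.
rewrite card_ord => extremal le; split=> //; split=> [/extremal[X [pX cX cvX FX]]|].
  have [_ tX X0] := and3P pX.
  exists X; split=> //; first by rewrite /is_partition tX.
  (* [X] has [t] nonempty blocks covering [t] points, so the termwise bound 1 <= [#|B|] is an
     equality throughout. *)
  have : \sum_(B in X) 1 = \sum_(B in X) #|B|.
    by rewrite -(card_partition pX) cvX sum1_card.
  have ge B : B \in X -> 1 <= #|B| ?= iff (#|B| == 1).
    move=> BX; apply/leqifP; case: eqP => [->//|/eqP B1].
    by rewrite ltn_neqAle eq_sym B1 card_gt0 (partition_neq0 pX).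
  have /leqif_sum[_] := ge; move=> E /eqP; rewrite E => /forall_inP H B BX.
  by apply/eqP/H.
case=> X [pX cX X1 FX]; apply: eq_bigr => i _.
by rewrite FX //; apply: (singletons X).
Qed.
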